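(* If $X$ is a $CC$-normal, first-countable, regular topological space, then $X$ is a $CCS$-normal space.
   Context: A topological space $X$ is called cellular-compact if for any disjoint (i.e. pairwise disjoint) family $\mathcal{U}$ of non-empty open subsets of $X$ there exists a compact subset $K$ of $X$ such that $K\cap U\neq\emptyset$ for every $U\in\mathcal{U}$. A subset is called cellular-compact if it is cellular-compact in its subspace topology. A space $X$ is called $CCS$-normal (resp. $CC$-normal) if there exist a normal space $Y$ and a bijection $f:X\to Y$ such that $f|_C:C\to f(C)$ is a homeomorphism (subspace topologies) for every cellular-compact (resp. countably compact) subspace $C$ of $X$. The map $f$ itself is not assumed continuous. *)

(* Defs.v *)
From mathcomp Require Import all_boot all_order all_algebra.
From mathcomp Require Import all_classical topology.

Set Implicit Arguments.
Unset Strict Implicit.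
Unset Printing Implicit Defensive.

Local Open Scope classical_set_scope.

(* The library's [regular_space] and [normal_space] do not include any T0/T1
   axiom, and [compact] does not include Hausdorff. *)

(* A subset [C : set T], used as a type, carries the subspace topology
   (library file [subtype_topology]). *)

Definition first_countable (T : topologicalType) : Prop :=
  forall x : T, exists2 B : set (set T), countable B &
    B `<=` nbhs x /\ forall V, nbhs x V -> exists2 U, B U & U `<=` V.

Definition cellular_compact (T : topologicalType) : Prop :=
  forall F : set (set T),
    (forall U, F U -> open U /\ U !=set0) -> trivIset F id ->
  exists2 K : set T, compact K & forall U, F U -> K `&` U !=set0.

Definition countably_compact (T : topologicalType) : Prop :=
  forall U : nat -> set T,
    (forall n, open (U n)) -> [set: T] `<=` cover [set: nat] U ->
  finite_subset_cover [set: nat] U [set: T].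

Definition homeomorphism (S T : topologicalType) (f : S -> T) : Prop :=
  continuous f /\
  exists2 g : T -> S, continuous g & cancel f g /\ cancel g f.

Definition restr_image (X Y : Type) (f : X -> Y) (C : set X) (x : C) :
    f @` C :=
  SigSub (image_f f (valP x)).

Definition CCS_normal (X : topologicalType) : Prop :=
  exists (Y : topologicalType) (f : X -> Y),
    [/\ normal_space Y, bijective f &
        forall C : set X, cellular_compact C ->
          homeomorphism (@restr_image X Y f C)].

Definition CC_normal (X : topologicalType) : Prop :=
  exists (Y : topologicalType) (f : X -> Y),
    [/\ normal_space Y, bijective f &
        forall C : set X, countably_compact C ->
          homeomorphism (@restr_image X Y f C)].

(* Main.v *)
Require Import Defs.
From mathcomp Require Import all_boot all_order all_algebra.
From mathcomp Require Import all_classical topology.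

(** A regular first-countable cellular-compact space [T] is countably compact.
    Otherwise there are increasing open sets [G n] that cover [T] while no [G n]
    equals [T].  For each [n] in the infinite set of indices with
    [G n.+1 `\` G n !=set0], pick [x n] in this difference; regularity gives the
    [x n] pairwise disjoint neighbourhoods [V n].  Inside [V n] a shrinking
    countable base at [x n] yields a disjoint family of open sets such that
    every set meeting all of them has [x n] in its closure.  A compact [K]
    meeting all members of all these families would then meet the complement of
    every [G n], which is impossible.  Regularity and first countability are
    hereditary, so the map witnessing CC-normality witnesses CCS-normality. *)

Local Open Scope classical_set_scope.

Lemma regular_shrink (T : topologicalType) (x : T) (A : set T) :
  regular_space T -> nbhs x A ->
  exists O : set T, [/\ open O, O x & closure O `<=` A].
Proof.
move=> reg xA; have [B xB BA] := reg x A xA; exists B°%classic; split.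
- exact: open_interior.
- exact: xB.
- by apply: subset_trans BA; apply: closureS; exact: interior_subset.
Qed.

Lemma regular_space_set_type (X : topologicalType) (C : set X) :
  regular_space X -> regular_space C.
Proof.
move=> reg x A xA; case: xA => _ [[U oU <-] Ux] UA.
have [O [oO Ox OU]] := regular_shrink _ _ _ reg (open_nbhs_nbhs (conj oU Ux)).
exists (set_val @^-1` O).
  by exists (set_val @^-1` O); split => //; exists O.
(* The inclusion is continuous, so a point in the closure of the trace of [O] lies in
   [closure O]. *)
move=> y yO; apply: UA; apply: OU => B yB.
have [|z [Oz Bz]] := yO (set_val @^-1` B); last by exists (set_val z).
exact: (@initial_continuous C X set_val y).
Qed.

Lemma first_countable_set_type (X : topologicalType) (C : set X) :
  first_countable X -> first_countable C.
Proof.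
move=> fc x; have [B cB [Bx BP]] := fc (set_val x).
exists [set set_val @^-1` U | U in B].
  exact: sub_countable (card_image_le _ _) cB.
split.
  by move=> _ [U /Bx xU <-]; exact: (@initial_continuous C X set_val x).
move=> A xA; case: xA => _ [[U oU <-] Ux] UA.
have [U' BU' U'U] := BP _ (open_nbhs_nbhs (conj oU Ux)).
exists (set_val @^-1` U'); first by exists U'.
by move=> y /U'U; exact: UA.
Qed.

Lemma first_countable_seq (T : topologicalType) (x : T) :
  first_countable T ->
  exists C : nat -> set T, (forall n, nbhs x (C n)) /\
    forall A, nbhs x A -> exists n, C n `<=` A.
Proof.
move=> /(_ x)[B /countable_injP[f finj] [Bx BP]].
(* By injectivity at most one [U] in [B] has index [n]; an index without such a [U] gives an empty
   intersection, the whole space. *)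
exists (fun n => \bigcap_(U in [set U | B U /\ f U = n]) U); split=> [n|A].
  have [[U [BU fU]]|nU] := pselect (exists U, B U /\ f U = n).
    apply: filterS (Bx _ BU) => y Uy V [BV fV].
    by rewrite (finj V U) ?inE// fV fU.
  by apply: filterS filterT => y _ V BV; case: nU; exists V.
by move=> /BP[U BU UA]; exists (f U) => y /(_ U) Uy; apply: UA; exact: Uy.
Qed.

Lemma regular_first_countable_base (T : topologicalType) (x : T) (V : set T) :
  regular_space T -> first_countable T -> nbhs x V ->
  exists W : nat -> set T, [/\ forall n, open (W n), forall n, W n x,
    W 0%N `<=` V, forall n, closure (W n.+1) `<=` W n &
    forall A, nbhs x A -> exists n, W n `<=` A].
Proof.
move=> reg /(first_countable_seq _ x)[C [Cx CP]] xV.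
have /choice[s sP] : forall A : set T, exists O : set T, nbhs x A ->
    [/\ open O, O x & closure O `<=` A].
  move=> A; have [xA|nxA] := pselect (nbhs x A); last by exists set0.
  by have [O OP] := regular_shrink _ _ _ reg xA; exists O.
(* Intersecting with [C m] before shrinking makes the sequence a base at [x]; [s] is total, so the
   recursion can precede the proof that each [W n] is a neighbourhood. *)
pose W := fix W n := if n is m.+1 then s (W m `&` C m) else s V.
have W_nbhs n : open (W n) /\ W n x.
  elim: n => [|n [oW Wx]]; first by have [] := sP _ xV.
  by have [] := sP (W n `&` C n) (filterI (open_nbhs_nbhs (conj oW Wx)) (Cx n)).
have WS n : closure (W n.+1) `<=` W n `&` C n.
  by have [] := sP (W n `&` C n) (filterI (open_nbhs_nbhs (W_nbhs n)) (Cx n)).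
exists W; split=> [n|n||n|A /CP[n CA]].
- by have [] := W_nbhs n.
- by have [] := W_nbhs n.
- by have [_ _ /(subset_trans (@subset_closure _ _))] := sP _ xV.
- by move=> y /WS[].
- by exists n.+1 => y /subset_closure/WS[_ /CA].
Qed.

(** The open layers [W m] minus [closure (W m.+1)] are disjoint, and those of index at least [m] lie
    in [W m]. If infinitely many are nonempty, a set meeting all of these comes arbitrarily close to
    [x]; otherwise a single open set suffices. *)
Lemma disjoint_family_at (T : topologicalType) (x : T) (V : set T) :
  regular_space T -> first_countable T -> nbhs x V ->
  exists F : set (set T), [/\ forall U, F U -> open U /\ U !=set0,
    trivIset F id, forall U, F U -> U `<=` V &
    forall K, (forall U, F U -> K `&` U !=set0) -> closure K x].
Proof.
move=> reg fc xV.
have [W [oW Wx WV WS WP]] := regular_first_countable_base _ _ _ reg fc xV.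
have Wle m n : (m <= n)%N -> W n `<=` W m.
  move=> /subnK <-; elim: (n - m)%N => [|k IHk] //=.
  by rewrite addSn => y /subset_closure/WS/IHk.
pose P m := W m `\` closure (W m.+1).
have [Pinf|] := pselect (forall m, exists2 k, (m <= k)%N & P k !=set0).
  exists [set U | U !=set0 /\ exists m, U = P m]; split.
  - move=> U [+ [m Um]]; rewrite Um; split=> //.
    by apply: openI => //; apply: closed_openC; exact: closed_closure.
  - have Pdisj m n : (m < n)%N -> P m `&` P n = set0.
      move=> mn; apply/seteqP; split=> // y [[_ nWy] [Wy _]].
      by apply: nWy; apply: subset_closure; apply: Wle Wy.
    move=> _ _ [_ [m ->]] [_ [n ->]]; case: (ltngtP m n) => [/Pdisj|/Pdisj|->//].
      by move=> /= -> [].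
    by rewrite setIC /= => -> [].
  - move=> _ [_ [m ->]] y [Wy _]; apply: WV; exact: Wle Wy.
  - move=> K KP A /WP[m WA]; have [k mk Pk] := Pinf m.
    have [|y [Ky [Wy _]]] := KP (P k); first by split => //; exists k.
    by exists y; split => //; apply: WA; exact: Wle Wy.
(* Once the differences [P k] are empty, [W k] is closed and the sequence is
   constant, so [W m] is the least neighbourhood of [x]. *)
move=> /existsNP[m Pm].
have WE k : (m <= k)%N -> W k = closure (W k.+1).
  move=> mk; apply/seteqP; split=> [y Wy|]; last exact: WS.
  apply: contrapT => nWy; apply: Pm; exists k => //; by exists y.
have Wmin k : (m <= k)%N -> W m `<=` W k.
  move=> /subnK <-; elim: (k - m)%N => [|j IHj] //=.
  (* [W (j + m)] is the closure of [W (j + m).+1], which is itself a closure, hence closed. *)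
  apply: subset_trans IHj _; rewrite addSn {1}WE ?leq_addl//.
  have {1 2}-> := WE (j + m).+1 (leqW (leq_addl _ _)).
  by rewrite -(proj1 (closure_id _) (@closed_closure _ _)).
exists [set W m]; split.
- by move=> _ ->; split => //; exists x.
- by move=> _ _ -> ->.
- by move=> _ ->; apply: subset_trans WV; exact: Wle.
- move=> K /(_ _ erefl)[y [Ky Wy]] A /WP[k WA]; exists y; split => //.
  apply: WA; have [mk|/ltnW km] := leqP m k; first exact: Wmin Wy.
  exact: Wle Wy.
Qed.

(* Substitutes for "compact sets are closed" in the absence of T1. *)
Lemma regular_compact_closure (T : topologicalType) (K F : set T) (x : T) :
  regular_space T -> compact K -> closed F -> closure K x -> F x ->
  K `&` F !=set0.
Proof.
move=> reg /compact_near_coveringP cK cF Kx Fx.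
apply: contrapT => KF0.
(* If [K] misses [F], each [y] in [K] has a neighbourhood [O] whose closure misses [x]; compactness
   combines these into one neighbourhood of [x] disjoint from [K]. *)
have : \forall a \near x, K `<=` (fun y => y <> a).
  apply: cK => y Ky.
  have nFy : nbhs y (~` F).
    apply: open_nbhs_nbhs; split; first exact: closed_openC.
    by move=> Fy; apply: KF0; exists y.
  have [O [oO Oy OF]] := regular_shrink _ _ _ reg nFy.
  exists (O, ~` closure O).
    split; apply: open_nbhs_nbhs; split=> //=; last by move=> /OF.
    by apply: closed_openC; exact: closed_closure.
  by move=> [z a] /= [Oz naO] za; apply: naO; rewrite -za; exact: subset_closure.
by move=> /Kx[y [Ky /(_ _ Ky)]].
Qed.

Lemma compact_nondecreasing_cover (T : topologicalType) (K : set T)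
    (G : nat -> set T) :
  compact K -> (forall n, open (G n)) ->
  (forall m n, (m <= n)%N -> G m `<=` G n) -> K `<=` \bigcup_n G n ->
  exists n, K `<=` G n.
Proof.
move=> /compact_near_coveringP cK oG Gle KG.
have [N _ NP] : \forall n \near \oo, K `<=` G n.
  apply: cK => y /KG[n _ Gy].
  exists (G n, [set k | (n <= k)%N]).
    by split; [exact: open_nbhs_nbhs (conj (oG n) Gy)|exists n].
  by move=> [z k] /= [Gz nk]; exact: Gle Gz.
by exists N; apply: NP => /=.
Qed.

Lemma not_countably_compact (T : topologicalType) :
  ~ countably_compact T ->
  exists G : nat -> set T, [/\ forall n, open (G n),
    forall m n, (m <= n)%N -> G m `<=` G n,
    forall x, exists n, G n x & forall n, exists x, ~ G n x].
Proof.
move=> /existsNP[U /not_implyP[oU] /not_implyP[Ucov Unfin]].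
exists (fun n => \bigcup_(i in `I_n) U i); split.
- by move=> n; apply: bigcup_open.
- by move=> m n mn x [i /= im Ux]; exists i => //=; exact: leq_trans mn.
- by move=> x; have [i _ Ux] := Ucov x I; exists i.+1; exists i => /=.
- move=> n; apply/existsNP => Gn; apply: Unfin.
  exists (fset_set `I_n); first by move=> i _; rewrite inE.
  move=> x _; have [i im Ux] := Gn x; exists i => //=.
  by rewrite in_fset_set// mem_set.
Qed.

Lemma cellular_compact_countably_compact (T : topologicalType) :
  regular_space T -> first_countable T ->
  cellular_compact T -> countably_compact T.
Proof.
move=> reg fc cc; apply: contrapT => /not_countably_compact[G [oG Gle Gcov Gn]].
pose D n := G n.+1 `\` G n.
have Dunb n : exists2 m, (n <= m)%N & D m !=set0.
  have [x nGx] := Gn n; have [k Gkx] := Gcov x.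
  (* The first index whose [G] contains [x] is positive, since [G 0] lies in [G n]; its predecessor
     is the index sought. *)
  have [m Gmx mmin] := ex_minnP (ex_intro (fun k => `[< G k x >]) k (asboolT Gkx)).
  case: m Gmx mmin => [|m] /asboolP Gmx mmin.
    by case: nGx; apply: Gle Gmx.
  have nGmx : ~ G m x by move=> /asboolT/mmin; rewrite ltnn.
  exists m; last by exists x.
  by rewrite leqNgt; apply/negP => mn; apply: nGx; apply: Gle Gmx.
have /choice[p pP] : forall n, exists p : T * set T, D n !=set0 ->
    [/\ D n p.1, open p.2, p.2 p.1 & closure p.2 `<=` G n.+1].
  move=> n; have [[x Dx]|nD] := pselect (D n !=set0); last first.
    by have [x _] := Gn 0; exists (x, set0).
  have [O [oO Ox OG]] :=
    regular_shrink _ _ _ reg (open_nbhs_nbhs (conj (oG n.+1) Dx.1)).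
  by exists (x, O).
(* The closed sets [closure (p k).2] may be removed from [(p n).2] because they
   lie in [G n], which misses [(p n).1]. *)
pose V n := (p n).2 `\` \bigcup_(k in [set k | (k < n)%N /\ D k !=set0])
  closure (p k).2.
have Vx n : D n !=set0 -> nbhs (p n).1 (V n).
  move=> Dn; have [[_ nGx] oO Ox _] := pP n Dn.
  apply: open_nbhs_nbhs; split.
    apply: openI => //; apply: closed_openC; apply: closed_bigcup => //.
      by apply: sub_finite_set (finite_II n) => k [].
    by move=> k _; exact: closed_closure.
  split => // -[k [kn Dk]]; have [_ _ _ OG] := pP k Dk.
  by move=> /OG Gx; apply: nGx; apply: Gle Gx.
have Vdisj m n x : (m < n)%N -> D m !=set0 -> V m x -> V n x -> False.
  move=> mn Dm [Ox _] [_]; apply; exists m => //; exact: subset_closure.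
have /choice[F FP] : forall n, exists F : set (set T), D n !=set0 ->
    [/\ forall U, F U -> open U /\ U !=set0, trivIset F id,
      forall U, F U -> U `<=` V n &
      forall K, (forall U, F U -> K `&` U !=set0) -> closure K (p n).1].
  move=> n; have [/Vx Dn|] := pselect (D n !=set0); last by exists set0.
  by have [F FP] := disjoint_family_at _ _ _ reg fc Dn; exists F.
have [||K cK KF] := cc (\bigcup_(n in [set n | D n !=set0]) F n).
- by move=> U [n Dn]; have [FU _ _ _] := FP n Dn; exact: FU.
- move=> U1 U2 [m /= Dm FU1] [n /= Dn FU2] [x [U1x U2x]].
  have [_ mtriv mV _] := FP m Dm; have [_ _ nV _] := FP n Dn.
  have V1 := mV _ FU1 _ U1x; have V2 := nV _ FU2 _ U2x.
  case: (ltngtP m n) => [mn|nm|mn]; first by case: (Vdisj _ _ _ mn Dm V1 V2).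
    by case: (Vdisj _ _ _ nm Dn V2 V1).
  by apply: mtriv => //; [rewrite mn|exists x].
have [|N KN] := compact_nondecreasing_cover _ _ _ cK oG Gle.
  by move=> x _; have [n Gx] := Gcov x; exists n.
have [n Nn Dn] := Dunb N.
have [[_ nGx] _ _ _] := pP n Dn.
have Kx : closure K (p n).1.
  by have [_ _ _] := FP n Dn; apply => U FU; apply: KF; exists n.
(* The point [(p n).1] itself may lie outside [K], but [K] still meets the closed complement of
   [G n], although [K] lies in [G N] and [G N] in [G n]. *)
have [|x [/KN Gx]] := regular_compact_closure _ _ (~` G n) _ reg cK _ Kx nGx.
  exact: open_closedC.
by apply; exact: Gle Gx.
Qed.

Theorem theorem2p5 (X : topologicalType) (hCC : CC_normal X)
  (hfc : first_countable X) (hreg : @regular_space X) : CCS_normal X.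
Proof.
have [Y [f [nY bf fC]]] := hCC; exists Y, f; split => // C cC.
apply: fC; apply: cellular_compact_countably_compact cC.
- exact: regular_space_set_type.
- exact: first_countable_set_type.
Qed.
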